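(* Let $N\ge3$, $M\ge2$, and let $\mathcal{F}$ be an $M\times N$ circular Florentine rectangle over $\mathbb{Z}_N$ with rows $\pi_0,\dots,\pi_{M-1}$; put $g_{i,j}=\pi_i^{-1}(j)$. Let $T\ge1$, $P=N+T$, $L=NP$, let $\mathcal{I}\subseteq\mathbb{Z}_P$ with $|\mathcal{I}|=T$, and write $\mathbb{Z}_P\setminus\mathcal{I}=\{l_0<l_1<\dots<l_{N-1}\}$. Let $a^i_{j,t}=\sqrt{P/N}\,\omega_N^{j g_{i,t}}$ and define the $N\times P$ matrix $\mathcal{B}^i=(b^i_{j,k})$ by $b^i_{j,k}=a^i_{j,t}\omega_{NP}^{k g_{i,t}}$ if $k=l_t$, and $b^i_{j,k}=0$ if $k\in\mathcal{I}$. Let $\hat u^i_n=b^i_{r,s}$ with $r=\lfloor n/P\rfloor$, $s=n-Pr$ ($0\le n<L$), and let $U^i$ be the time-domain sequence $u^i_t=\frac{1}{\sqrt L}\sum_{n=0}^{L-1}\hat u^i_n\omega_L^{nt}$. With $\theta_a=\max\{|\theta_{U^i}(\tau)|:0\le i<M,\ 0<\tau<L\}$ and $\theta_c=\max\{|\theta_{U^i,U^{i'}}(\tau)|:i\ne i',\ 0\le\tau<L\}$: (1) $\theta_a\ge P\sqrt{\frac{N(P-N)}{P-1}}$, with equality if $\mathbb{Z}_P\setminus\mathcal{I}$ is a cyclic difference set over $\mathbb{Z}_P$; (2) $\theta_c=P$; (3) with $\Omega=\{s+aP:s\in\mathcal{I},a\in\mathbb{Z}_N\}$, for every $i$ one has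 $\hat u^i_n=0$ for $n\in\Omega$ and $|\hat u^i_n|=\sqrt{P/N}$ for $n\notin\Omega$.
   Context: $\omega_n=e^{2\pi\sqrt{-1}/n}$. An $M\times N$ circular Florentine rectangle (CFR) over $\mathbb{Z}_N$ is an $M\times N$ array whose rows $\pi_i:\mathbb{Z}_N\to\mathbb{Z}_N$ are permutations such that for every $m\in\mathbb{Z}_N\setminus\{0\}$ and all $i,j,x,y$: $(\pi_i(x),\pi_i(x+m))=(\pi_j(y),\pi_j(y+m))$ (indices mod $N$) iff $i=j$ and $x=y$. $\pi_i^{-1}$ is the inverse permutation with values in $\{0,\dots,N-1\}$. Periodic correlation: $\theta_{C,D}(\tau)=\sum_{t=0}^{L-1}c_td^*_{\langle t+\tau\rangle_L}$, $\theta_C=\theta_{C,C}$. A subset $\mathcal{D}\subseteq\mathbb{Z}_v$ with $|\mathcal{D}|=k$ is a $(v,k,\lambda)$ cyclic difference set if $|(\varepsilon+\mathcal{D})\cap\mathcal{D}|=\lambda$ for every nonzero $\varepsilon\in\mathbb{Z}_v$. *)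

(* Defs.v *)
From mathcomp Require Import all_boot all_order all_algebra all_fingroup.
From mathcomp Require Import reals trigo.
From mathcomp.real_closed Require Import complex.
Set Implicit Arguments.
Unset Strict Implicit.
Unset Printing Implicit Defensive.
Import Order.TTheory GRing.Theory Num.Theory.
Local Open Scope ring_scope.

Definition addI (n : nat) (x : 'I_n) (m : nat) : 'I_n :=
  Ordinal (ltn_pmod (x + m)%N (leq_ltn_trans (leq0n x) (ltn_ord x))).

Definition CFR (M N : nat) (pi : 'I_M -> {perm 'I_N}) : Prop :=
  forall m : 'I_N, val m != 0%N ->
  forall (i j : 'I_M) (x y : 'I_N),
    ((pi i x, pi i (addI x m)) = (pi j y, pi j (addI y m))) <-> (i = j /\ x = y).

Definition cyclic_difference_set (v k lam : nat) (D : {set 'I_v}) : Prop :=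
  #|D| = k /\
  forall e : 'I_v, val e != 0%N -> #|[set addI d e | d in D] :&: D| = lam.

Section Construction.
Variable R : realType.
Local Open Scope complex_scope.
Local Open Scope ring_scope.

Definition omega (n : nat) : R[i] :=
  (cos (2 * pi / n%:R))%:C + 'i * (sin (2 * pi / n%:R))%:C.

Definition cabs (z : R[i]) : R := ComplexField.Normc.normc z.

Variables (M N P L : nat) (pi : 'I_M -> {perm 'I_N}) (I : {set 'I_P}).

Definition gidx (i : 'I_M) (t : 'I_N) : nat := val ((pi i)^-1%g t).

Definition lseq : seq nat := sort leq [seq val k | k in ~: I].
Definition lidx (t : nat) : nat := nth 0%N lseq t.

Definition acoef (i : 'I_M) (j : nat) (t : 'I_N) : R[i] :=
  (Num.sqrt (P%:R / N%:R))%:C * omega N ^+ (j * gidx i t).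

(* b^i_{j,k} = a^i_{j,t} omega_{NP}^{k g_{i,t}} if k = l_t, and 0 if k in I
   (the sum has at most one nonzero term since the l_t are distinct) *)
Definition bcoef (i : 'I_M) (j k : nat) : R[i] :=
  \sum_(t < N | k == lidx t) acoef i j t * omega (N * P) ^+ (k * gidx i t).

Definition uhat (i : 'I_M) (n : nat) : R[i] := bcoef i (n %/ P) (n %% P).

Definition useq (i : 'I_M) (t : nat) : R[i] :=
  (Num.sqrt L%:R)^-1%:C * \sum_(n < L) uhat i n * omega L ^+ (n * t).

Definition corr (c d : nat -> R[i]) (tau : nat) : R[i] :=
  \sum_(t < L) c t * (d ((t + tau) %% L)%N)^*.

Definition theta_a : R :=
  \big[Num.max/0]_(i < M) \big[Num.max/0]_(tau < L | (0 < tau)%N)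
     cabs (corr (useq i) (useq i) tau).

Definition theta_c : R :=
  \big[Num.max/0]_(i < M) \big[Num.max/0]_(i' < M | i != i')
     \big[Num.max/0]_(tau < L) cabs (corr (useq i) (useq i') tau).

Definition inOmega (n : nat) : Prop :=
  exists (s : 'I_P) (a : nat), [/\ s \in I, (a < N)%N & n = (s + a * P)%N].

End Construction.

(* Main.v *)
Require Import Defs.
From mathcomp Require Import all_boot all_order all_algebra all_fingroup.
From mathcomp Require Import reals trigo.
From mathcomp.real_closed Require Import complex.
From mathcomp Require Import zify ring lra.
Import Order.TTheory GRing.Theory Num.Theory.
Local Open Scope ring_scope.

(** With [z = omega_L], the spectrum on the residue class [n = l_t] mod [P] is
    [uhat i n = sqrt(P/N) z^(n g_(i,t))].  Hence the correlation, computed in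
    the frequency domain, is a sum over [t] of geometric sums, and equals
    [P] times the sum of [z^(l_t (g_(i,t) - g_(i',t) - tau))] over those [t]
    with [g_(i,t) - g_(i',t) = tau] mod [N].  For distinct rows the Florentine
    property leaves exactly one [t], so every cross-correlation has modulus
    [P].  For equal rows the value vanishes unless [N] divides [tau], and then
    it is [P] times a character sum over the complement of [I]; the average of
    the squared moduli of the nontrivial character sums is
    [N (P - N) / (P - 1)], and they are all equal for a difference set. *)

(** * Roots of unity and finite Fourier sums *)

Lemma sum_expr_unity_root (F : fieldType) (n : nat) (x : F) :
  x ^+ n = 1 -> \sum_(i < n) x ^+ i = if x == 1 then n%:R else 0.
Proof.
move=> xn1; case: eqP => [->|/eqP x1].
  by under eq_bigr do rewrite expr1n; rewrite sumr_const card_ord.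
have/esym/eqP := subrX1 x n.
by rewrite xn1 subrr mulf_eq0 subr_eq0 (negbTE x1) => /eqP.
Qed.

Lemma unity_root_norm (C : numClosedFieldType) (n : nat) (z : C) :
  (0 < n)%N -> z ^+ n = 1 -> `|z| = 1.
Proof.
by move=> n0 zn1; apply/eqP; rewrite -(pexpr_eq1 n0) // -normrX zn1 normr1.
Qed.

Lemma unity_root_conjC (C : numClosedFieldType) (n : nat) (z : C) :
  (0 < n)%N -> z ^+ n = 1 -> z^* = z^-1.
Proof.
move=> n0 zn1.
by rewrite invC_norm (unity_root_norm _ _ _ n0 zn1) expr1n invr1 mul1r.
Qed.

Lemma prim_root_neq0 (F : fieldType) (n : nat) (z : F) :
  n.-primitive_root z -> z != 0.
Proof.
move=> zP; apply/eqP => z0; have := prim_expr_order zP.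
rewrite z0 expr0n gtn_eqF ?(prim_order_gt0 zP) //= => /eqP.
by rewrite eq_sym oner_eq0.
Qed.

Lemma prim_root_orthogonality (F : fieldType) (n : nat) (z : F) :
  n.-primitive_root z -> forall a b : nat,
  \sum_(t < n) (z ^+ a / z ^+ b) ^+ t = if a == b %[mod n] then n%:R else 0.
Proof.
move=> zP a b; rewrite sum_expr_unity_root; last first.
  by rewrite expr_div_n -!exprM mulnC exprM mulnC exprM (prim_expr_order zP)
             !expr1n divr1.
rewrite -(eq_prim_root_expr zP) -subr_eq0 -[X in _ - X](divff (x := z ^+ b)).
  rewrite -mulrBl mulf_eq0 invr_eq0 expf_eq0.
  by rewrite (negbTE (prim_root_neq0 _ _ _ zP)) andbF orbF subr_eq0.
by rewrite expf_eq0 (negbTE (prim_root_neq0 _ _ _ zP)) andbF.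
Qed.

(** Parseval with a shift: once both transforms are expanded, summing over [t] first kills every
    pair of distinct frequencies, and the shift survives as the phase [z^(- n tau)]. *)
Lemma dft_correlation (C : numClosedFieldType) (L : nat) (z s : C)
    (a b : nat -> C) (tau : nat) :
  L.-primitive_root z ->
  \sum_(t < L) (s * \sum_(n < L) a n * z ^+ (n * t)) *
     (s * \sum_(n < L) b n * z ^+ (n * ((t + tau) %% L)))^* =
  s * s^* * L%:R * \sum_(n < L) a n * (b n)^* * (z^-1) ^+ (n * tau).
Proof.
move=> zP; have L0 := prim_order_gt0 zP.
have cz : z^* = z^-1 := unity_root_conjC _ _ _ L0 (prim_expr_order zP).
(* Since [z^L = 1], the cyclic reduction of [t + tau] is invisible to powers of [z]. *)
have zred m t : z ^+ (m * ((t + tau) %% L)) = z ^+ (m * t) * z ^+ (m * tau).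
  rewrite -exprD -mulnDr; apply/eqP; rewrite (eq_prim_root_expr zP).
  by rewrite modnMmr.
transitivity (\sum_(t < L) \sum_(n < L) \sum_(m < L)
   s * s^* * (a n * (b m)^* * (z^-1) ^+ (m * tau)) * (z ^+ n / z ^+ m) ^+ t).
  apply: eq_bigr => t _; rewrite mulr_sumr mulr_suml; apply: eq_bigr => n _.
  rewrite rmorphM rmorph_sum !mulr_sumr; apply: eq_bigr => m _.
  rewrite zred !rmorphM !rmorphXn /= cz !exprVn expr_div_n !exprM.
  by rewrite -!exprVn; ring.
rewrite exchange_big /= mulr_sumr; apply: eq_bigr => n _.
rewrite exchange_big /= (bigD1 n) //= -mulr_sumr prim_root_orthogonality //.
rewrite eqxx big1 ?addr0 => [|m mn]; first by ring.
rewrite -mulr_sumr prim_root_orthogonality // !modn_small //.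
by rewrite val_eqE eq_sym (negbTE mn) mulr0.
Qed.

Lemma sum_residue_class (V : nmodType) (N P l : nat) (F : nat -> V) :
  (l < P)%N ->
  \sum_(n < N * P | (n %% P == l)%N) F n = \sum_(r < N) F (r * P + l)%N.
Proof.
move=> lP; rewrite big_mkcond /=.
rewrite -(big_mkord xpredT (fun n => if (n %% P)%N == l then F n else 0)).
(* The range splits into [N] blocks of length [P]; in each block only the offset [l] contributes. *)
rewrite big_nat_mul big_mkord; apply: eq_bigr => r _.
rewrite -{1}[(r * P)%N]add0n big_addn mulSn addnK big_mkord.
rewrite (bigD1 (Ordinal lP)) //= addnC modnMDl modn_small // eqxx.
rewrite big1 ?addr0 // => s sl; rewrite addnC modnMDl modn_small //.
by rewrite (negbTE (_ : val s != l)) // -[l]/(val (Ordinal lP)) val_eqE.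
Qed.

(** * Cyclic shifts and character sums over a subset of Z_P *)

Lemma addI_inj (n m : nat) : injective (@addI n ^~ m).
Proof.
move=> x y /(congr1 val) /= /eqP; rewrite eqn_modDr !modn_small //.
by move=> /eqP /val_inj.
Qed.

Lemma addI_bij (n : nat) (x : 'I_n) : bijective (fun m : 'I_n => addI x m).
Proof.
apply: injF_bij => m m' /(congr1 val) /= /eqP; rewrite eqn_modDl !modn_small //.
by move=> /eqP /val_inj.
Qed.

Section CharacterSums.
Variables (C : numClosedFieldType) (P : nat) (w : C) (D : {set 'I_P}).
Hypothesis wP : P.-primitive_root w.

(** The discrete Fourier transform of the indicator function of [D]. *)
Definition char_sum (tau : nat) : C := \sum_(d in D) (w ^+ tau) ^+ d.

Let P0 : (0 < P)%N := prim_order_gt0 wP.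
Let w0 : w != 0 := prim_root_neq0 _ _ _ wP.

Lemma sqr_norm_char_sum tau :
  `|char_sum tau| ^+ 2 =
    \sum_(a in D) \sum_(b in D) (w ^+ a / w ^+ b) ^+ tau.
Proof.
have cw : w^* = w^-1 := unity_root_conjC _ _ _ P0 (prim_expr_order wP).
rewrite normCK /char_sum mulr_suml; apply: eq_bigr => a _.
rewrite rmorph_sum mulr_sumr; apply: eq_bigr => b _.
by rewrite !rmorphXn /= cw !exprVn expr_div_n -!exprM ![(tau * _)%N]mulnC.
Qed.

Lemma char_sum0 : char_sum 0 = #|D|%:R.
Proof.
by rewrite /char_sum expr0; under eq_bigr do rewrite expr1n; rewrite sumr_const.
Qed.

(** Parseval for the indicator of [D]: after summation over [tau] only the diagonal pairs remain,
    each contributing [P]. *)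
Lemma sum_sqr_norm_char_sum :
  \sum_(tau < P) `|char_sum tau| ^+ 2 = (P * #|D|)%:R.
Proof.
under eq_bigr do rewrite sqr_norm_char_sum.
rewrite exchange_big /= natrM mulr_natr -sumr_const; apply: eq_bigr => a aD.
rewrite exchange_big /= (bigD1 a) //= prim_root_orthogonality // eqxx.
rewrite big1 ?addr0 // => b /andP[_ ba].
by rewrite prim_root_orthogonality // !modn_small // val_eqE eq_sym (negbTE ba).
Qed.

Lemma sum_sqr_norm_char_sum_neq0 :
  \sum_(tau < P | (0 < tau)%N) `|char_sum tau| ^+ 2 =
    #|D|%:R * (P%:R - #|D|%:R).
Proof.
have := sum_sqr_norm_char_sum; rewrite (bigD1 (Ordinal P0)) //= char_sum0.
rewrite normr_nat natrM => E.
under eq_bigl => t do rewrite lt0n -[(t != 0 :> nat)%N]/(t != Ordinal P0).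
rewrite mulrBr mulrC -E; ring.
Qed.

(* Expand the square and group the pairs of elements of [D] by their
   difference [e]: each [e != 0] occurs [lam] times. *)
Lemma sqr_norm_char_sum_diffset k lam tau :
  cyclic_difference_set k lam D -> (0 < tau < P)%N ->
  `|char_sum tau| ^+ 2 = #|D|%:R - lam%:R.
Proof.
move=> [_ Dlam] /andP[tau0 tauP].
have wtau : (w ^+ tau) ^+ P = 1 by rewrite exprAC (prim_expr_order wP) expr1n.
have wtau1 : (w ^+ tau == 1) = false.
  rewrite -(prim_order_dvd wP); by apply/negbTE; rewrite gtnNdvd.
(* Elements of [D] in the translate by [e] correspond to the [b] in [D] with [b + e] in [D]. *)
have cardE (e : 'I_P) :
    \sum_(b in D | addI b e \in D) 1 = #|[set addI d e | d in D] :&: D|%:R :> C.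
  have -> : [set addI d e | d in D] :&: D =
      [set addI d e | d in [set b in D | addI b e \in D]].
    apply/setP => x; rewrite inE; apply/andP/imsetP => [[/imsetP[b bD ->] bD']|].
      by exists b; rewrite // inE bD.
    by move=> [b]; rewrite inE => /andP[bD bD'] ->; rewrite imset_f.
  rewrite (card_imset _ (addI_inj P e)) sumr_const; congr (_%:R).
  by apply: eq_card => b; rewrite inE.
transitivity (\sum_(e < P) (w ^+ tau) ^+ e *
    #|[set addI d e | d in D] :&: D|%:R).
  rewrite sqr_norm_char_sum exchange_big /=.
  under [RHS]eq_bigr do rewrite -cardE mulr_sumr big_mkcondr.
  rewrite [RHS]exchange_big /=; apply: eq_bigr => b bD.
  (* Write the first member of the pair as [a = b + e], so that the ratio [w^a / w^b] becomes
     [w^e]. *)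
  rewrite (reindex (fun m : 'I_P => addI b m)) /=; last first.
    exact/onW_bij/addI_bij.
  rewrite big_mkcond /=; apply: eq_bigr => e _; case: ifP => // _.
  rewrite mulr1 (prim_expr_mod wP) exprD mulrAC divff ?expf_neq0 // mul1r.
  by rewrite exprAC.
(* The term [e = 0] gives the size of [D]; the others give [lam] times a nontrivial character summed
   over [e != 0], which is [-1]. *)
rewrite (bigD1 (Ordinal P0)) //= expr0 mul1r.
have -> : [set addI d 0 | d in D] :&: D = D.
  apply/setP => x; rewrite inE andbC; case: (boolP (x \in D)) => //= xD.
  apply/imsetP; exists x => //; apply: val_inj; rewrite /= addn0 modn_small //.
under eq_bigr => e e0 do rewrite Dlam //.
rewrite -mulr_suml.
have := sum_expr_unity_root _ _ _ wtau; rewrite wtau1 (bigD1 (Ordinal P0)) //=.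
by rewrite expr0 => /eqP; rewrite addrC addr_eq0 => /eqP ->; rewrite mulN1r.
Qed.
End CharacterSums.

(** * The primitive roots of unity given by cosine and sine *)

Lemma cabsE (R : realType) (x : R[i]) : (cabs x)%:C%C = `|x|.
Proof. by rewrite normc_def; case: x. Qed.

Lemma omegaX (R : realType) (n k : nat) :
  omega R n ^+ k =
  (cos (2 * pi / n%:R * k%:R))%:C%C + 'i * (sin (2 * pi / n%:R * k%:R))%:C%C.
Proof.
elim: k => [|k IHk]; first by rewrite mulr0 cos0 sin0 mulr0 addr0.
rewrite exprS IHk /omega -[k.+1%:R]natr1 [_ * (k%:R + 1)]mulrDr mulr1.
rewrite cosD sinD rmorphB rmorphD !rmorphM /=.
have := sqrCi (R[i]); rewrite expr2 => ii.
by ring: ii.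
Qed.

(** The half angle [pi k / n] lies strictly between 0 and [pi], so its sine is positive and the real
    part [1 - 2 sin^2] differs from 1. *)
Lemma omegaX_neq1 (R : realType) (n k : nat) :
  (0 < k < n)%N -> omega R n ^+ k != 1.
Proof.
move=> /andP[k0 kn]; have n0 : (0 < n)%N by lia.
have n0R : 0 < n%:R :> R by rewrite ltr0n.
have k0R : 0 < k%:R :> R by rewrite ltr0n.
have knR : k%:R < n%:R :> R by rewrite ltr_nat.
have s0 : 0 < sin (pi / n%:R * k%:R) :> R.
  apply: sin_gt0_pi; rewrite !mulr_gt0 ?invr_gt0 ?pi_gt0 //=.
  by rewrite -mulrA gtr_pMr ?pi_gt0 // mulrC ltr_pdivrMr // mul1r.
apply/eqP; rewrite omegaX => /(congr1 (@complex.Re R)); rewrite -complexiE /=.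
rewrite !(mul0r, mulr0, subr0, addr0, mul1r).
have -> : 2 * pi / n%:R * k%:R = (pi / n%:R * k%:R) *+ 2 :> R by ring.
rewrite cos_mulr2n cos2sin2 => E; move: s0 E.
set s := sin _ => s0 E; have : s ^+ 2 = 0 by lra.
by move/eqP; rewrite sqrf_eq0 gt_eqF.
Qed.

Lemma omega_prim (R : realType) (n : nat) :
  (0 < n)%N -> n.-primitive_root (omega R n).
Proof.
move=> n0; have n0R : n%:R != 0 :> R by rewrite pnatr_eq0 -lt0n.
have on : omega R n ^+ n = 1.
  rewrite omegaX divfK // mulr_natl cos2pi sin2pi.
  by rewrite mulr0 addr0.
have [m mP mn] := prim_order_exists n0 on.
suff Emn : m = n by move: mP; rewrite Emn.
apply/eqP; rewrite eqn_leq (dvdn_leq n0 mn) leqNgt; apply/negP => lt_mn.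
have := omegaX_neq1 R n m; rewrite (prim_order_gt0 mP) lt_mn => /(_ isT).
by rewrite (prim_expr_order mP) eqxx.
Qed.

Lemma omega_mulX (R : realType) (N P : nat) :
  (0 < P)%N -> omega R (N * P) ^+ P = omega R N.
Proof.
move=> P0; have P0R : P%:R != 0 :> R by rewrite pnatr_eq0 -lt0n.
rewrite omegaX /omega natrM invfM mulrA divfK //.
Qed.

(** * The increasing enumeration of the complement of [I] *)

Section SortedComplement.
Variables (N P : nat) (I : {set 'I_P}).
Hypothesis cardI : #|~: I| = N.

(** Keeps every [t < N] inside the list, so the default 0 of [nth] in [lidx] is never returned. *)
Lemma size_lseq : size (lseq I) = N.
Proof. by rewrite size_sort size_map -cardE. Qed.

Lemma lseq_uniq : uniq (lseq I).
Proof. by rewrite sort_uniq map_inj_uniq ?enum_uniq //; apply: val_inj. Qed.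

Lemma lidx_inj (t t' : 'I_N) : lidx I t = lidx I t' -> t = t'.
Proof.
by move=> /eqP; rewrite /lidx nth_uniq ?size_lseq ?lseq_uniq // => /eqP/val_inj.
Qed.

Lemma lidx_notin (t : 'I_N) : exists2 k, k \notin I & lidx I t = val k.
Proof.
have : lidx I t \in lseq I by rewrite mem_nth ?size_lseq.
rewrite mem_sort => /mapP[k]; rewrite mem_enum inE => kI ->.
by exists k.
Qed.

Lemma lidx_surj (k : 'I_P) : k \notin I -> exists t : 'I_N, lidx I t = k.
Proof.
move=> kI; have kl : val k \in lseq I.
  by rewrite mem_sort map_f // mem_enum inE.
have := kl; rewrite -index_mem size_lseq => klt.
by exists (Ordinal klt); rewrite /lidx /= nth_index.
Qed.

Lemma sum_lidx (V : nmodType) (F : nat -> V) :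
  \sum_(t < N) F (lidx I t) = \sum_(d in ~: I) F d.
Proof.
rewrite -(big_mkord xpredT (fun t => F (lidx I t))) -size_lseq.
rewrite -(big_nth 0%N xpredT F) (perm_big [seq val k | k in ~: I]) /=; last first.
  by rewrite perm_sort.
by rewrite big_map big_enum.
Qed.
End SortedComplement.

(** * Spectra and correlations of the sequences *)

Lemma sqrt_mul_conjC (R : realType) (x : R) :
  0 <= x -> (Num.sqrt x)%:C%C * ((Num.sqrt x)%:C%C)^* = x%:C%C.
Proof.
move=> x0; rewrite conj_Creal; last by apply/complex_realP; exists (Num.sqrt x).
by rewrite -rmorphM /= -expr2 sqr_sqrtr.
Qed.

Section Sequences.
Variables (R : realType) (M N P : nat) (pi : 'I_M -> {perm 'I_N}).
Variable I : {set 'I_P}.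
Hypotheses (N0 : (0 < N)%N) (P0 : (0 < P)%N) (cardI : #|~: I| = N).

Notation z := (omega R (N * P)).
Notation c := ((Num.sqrt (P%:R / N%:R : R))%:C%C : R[i]).

Let NP0 : (0 < N * P)%N. Proof. by rewrite muln_gt0 N0. Qed.
Let zP : (N * P).-primitive_root z. Proof. exact: omega_prim. Qed.
Let z0 : z != 0. Proof. exact: (prim_root_neq0 _ _ _ zP). Qed.

Lemma omega_norm : `|z| = 1.
Proof. exact: (unity_root_norm _ _ _ NP0 (prim_expr_order zP)). Qed.

(** For [n = r P + l_t] the phases [omega_N^(r g)] and [z^(l_t g)] merge into [z^(n g)], because
    [omega_N = z^P]. *)
Lemma uhatE (i : 'I_M) (n : nat) (t : 'I_N) :
  (n %% P)%N = lidx I t -> uhat R pi I i n = c * z ^+ (n * gidx pi i t).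
Proof.
move=> nt; rewrite /uhat /bcoef nt (big_pred1 t) => [|t']; last first.
  by apply/eqP/eqP => [/lidx_inj ->|->].
rewrite /acoef -(omega_mulX R N P P0) -nt -mulrA; congr (_ * _).
rewrite -exprM -exprD mulnA -mulnDl [(P * _)%N]mulnC.
by rewrite -divn_eq.
Qed.

Lemma uhat_in (i : 'I_M) (n : nat) (k : 'I_P) :
  k \in I -> (n %% P)%N = k -> uhat R pi I i n = 0.
Proof.
move=> kI nk; rewrite /uhat /bcoef nk big1 // => t /eqP kt.
have [k' /negP k'I tk] := lidx_notin _ _ _ cardI t.
by case: k'I; rewrite -(val_inj (etrans kt tk)).
Qed.

(** The sum has one term when [n] mod [P] avoids [I] and none otherwise; this form covers both cases
    and lets the sums over [n] and [t] be exchanged. *)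
Lemma uhatM (i i' : 'I_M) (n : nat) :
  uhat R pi I i n * (uhat R pi I i' n)^* =
  \sum_(t < N | (n %% P)%N == lidx I t)
     P%:R / N%:R * (z ^+ gidx pi i t / z ^+ gidx pi i' t) ^+ n.
Proof.
pose k : 'I_P := Ordinal (ltn_pmod n P0).
have [kI|kI] := boolP (k \in I).
  rewrite (uhat_in i n k) // mul0r big1 // => t /eqP kt.
  have [k' /negP k'I tk] := lidx_notin _ _ _ cardI t.
  by case: k'I; rewrite -(val_inj (etrans kt tk : val k = val k')).
have [t kt] := lidx_surj _ _ _ cardI k kI.
rewrite (big_pred1 t) => [|t']; last first.
  have -> : (n %% P)%N = lidx I t by rewrite kt.
  by apply/eqP/eqP => [/lidx_inj ->|->].
rewrite !(uhatE _ _ t) //.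
have c2 : c * c^* = P%:R / N%:R.
  by rewrite sqrt_mul_conjC ?divr_ge0 // fmorph_div /= !rmorph_nat.
rewrite rmorphM rmorphXn mulrACA c2; congr (_ * _).
rewrite /= (unity_root_conjC _ _ _ NP0 (prim_expr_order zP)) exprVn.
by rewrite expr_div_n -!exprM ![(n * _)%N]mulnC.
Qed.

Lemma corr_useq (i i' : 'I_M) (tau : nat) :
  corr (N * P) (useq R (N * P) pi I i) (useq R (N * P) pi I i') tau =
  P%:R * \sum_(t < N | (gidx pi i t == gidx pi i' t + tau %[mod N])%N)
     (z ^+ gidx pi i t / z ^+ (gidx pi i' t + tau)) ^+ lidx I t.
Proof.
rewrite /corr /useq (dft_correlation _ _ _ _ _ _ _ zP).
have NP0R : (N * P)%:R != 0 :> R[i] by rewrite pnatr_eq0 -lt0n.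
(* The normalisation by [1 / sqrt L] makes the prefactor of the Parseval identity equal to 1. *)
rewrite -sqrtrV ?ler0n // sqrt_mul_conjC ?invr_ge0 ?ler0n //.
rewrite fmorphV rmorph_nat mulVf // mul1r.
transitivity (\sum_(t < N) \sum_(n < N * P | (n %% P)%N == lidx I t)
    P%:R / N%:R * (z ^+ gidx pi i t / z ^+ (gidx pi i' t + tau)) ^+ n).
  rewrite (exchange_big_dep xpredT) //=; apply: eq_bigr => n _.
  rewrite uhatM mulr_suml; apply: eq_bigr => t _.
  rewrite -[LHS]mulrA; congr (_ * _); rewrite [(n * tau)%N]mulnC exprM -exprMn exprVn.
  by rewrite exprD invfM mulrA.
rewrite mulr_sumr [RHS]big_mkcond /=; apply: eq_bigr => t _.
have [k _ tk] := lidx_notin _ _ _ cardI t.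
rewrite tk (sum_residue_class _ _ _ _ (fun n => P%:R / N%:R * _ ^+ n));
  last exact: ltn_ord.
(* Pulling out [x^k] leaves a geometric sum in [x^P], a ratio of powers of [omega_N]; it is [N] or
   0, and [N] cancels the denominator of [P / N]. *)
have geom (x : R[i]) : \sum_(r < N) P%:R / N%:R * x ^+ (r * P + k) =
    P%:R / N%:R * (\sum_(r < N) (x ^+ P) ^+ r) * x ^+ k.
  rewrite mulr_sumr mulr_suml; apply: eq_bigr => r _.
  by rewrite exprD mulrA -exprM [(P * r)%N]mulnC.
rewrite geom expr_div_n -!exprM [(gidx pi i t * P)%N]mulnC.
rewrite [((_ + tau) * P)%N]mulnC 2!exprM omega_mulX //.
rewrite prim_root_orthogonality; last exact: omega_prim.
case: ifP => _; last by rewrite mulr0 mul0r.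
by rewrite divfK ?pnatr_eq0 -?lt0n.
Qed.

(* Two distinct rows of a circular Florentine rectangle never place a pair of
   symbols at the same cyclic offset, so [t |-> gidx i t - gidx i' t] is a
   permutation of Z_N. *)
Lemma CFR_gidx_diff (i i' : 'I_M) (tau : nat) : CFR pi -> i != i' ->
  exists t : 'I_N, forall t' : 'I_N,
    (gidx pi i t' == gidx pi i' t' + tau %[mod N])%N = (t' == t).
Proof.
move=> piP ii'.
(* The difference of the two positions mod [N]; adding [N] first keeps the subtraction from
   truncating. *)
pose f (t : 'I_N) : 'I_N :=
  Ordinal (ltn_pmod (gidx pi i t + (N - gidx pi i' t))%N N0).
have gN j t : (gidx pi j t < N)%N by apply: ltn_ord.
have f_inj : injective f.
  move=> t t' /(congr1 val) /= /eqP E; apply/eqP/negPn/negP => tt'.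
  have E' : (gidx pi i t + gidx pi i' t' = gidx pi i t' + gidx pi i' t %[mod N])%N.
    move: E; rewrite -(eqn_modDr (gidx pi i' t + gidx pi i' t')).
    have -> : (gidx pi i t + (N - gidx pi i' t) + (gidx pi i' t + gidx pi i' t') =
      gidx pi i t + gidx pi i' t' + N)%N by have := gN i' t; lia.
    have -> : (gidx pi i t' + (N - gidx pi i' t') + (gidx pi i' t + gidx pi i' t') =
      gidx pi i t' + gidx pi i' t + N)%N by have := gN i' t'; lia.
    by rewrite !modnDr => /eqP.
  set x := (pi i)^-1%g t; set y := (pi i')^-1%g t.
  (* The offset from [t] to [t'] in row [i]; by [E'] it is also their offset in row [i']. *)
  pose m : 'I_N := Ordinal (ltn_pmod (gidx pi i t' + (N - gidx pi i t))%N N0).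
  have xm : addI x m = (pi i)^-1%g t'.
    apply: val_inj; rewrite /= modnDmr -[val x]/(gidx pi i t).
    rewrite addnCA subnKC ?(ltnW (gN _ _)) // modnDr modn_small //.
  have ym : addI y m = (pi i')^-1%g t'.
    apply: val_inj; rewrite /= modnDmr -[val y]/(gidx pi i' t).
    rewrite -[RHS]/(gidx pi i' t') -[RHS](@modn_small _ N) //.
    apply/eqP; rewrite -(eqn_modDr (gidx pi i t)).
    have -> : (gidx pi i' t + (gidx pi i t' + (N - gidx pi i t)) + gidx pi i t =
      gidx pi i t' + gidx pi i' t + N)%N by have := gN i t; lia.
    by rewrite modnDr -E' addnC.
  have m0 : val m != 0%N.
    apply/negP => /eqP m0; move: xm; rewrite /addI m0.
    move=> /(congr1 val) /=; rewrite addn0 modn_small // => /val_inj /perm_inj.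
    by apply/eqP.
  have := (piP m m0 i i' x y).1.
  rewrite xm ym !permKV => /(_ erefl) [/eqP].
  by rewrite (negbTE ii').
have [g fK gK] := injF_bij f_inj.
(* The witness is the preimage of [tau] mod [N] under the permutation [f]. *)
exists (g (Ordinal (ltn_pmod tau N0))) => t'.
rewrite -(inj_eq f_inj) gK -val_eqE /= -[RHS](eqn_modDr (gidx pi i' t')).
have -> : (gidx pi i t' + (N - gidx pi i' t') + gidx pi i' t' =
  gidx pi i t' + N)%N by have := gN i' t'; lia.
by rewrite modnDr addnC.
Qed.

Lemma corr_useq_cross (i i' : 'I_M) (tau : nat) : CFR pi -> i != i' ->
  cabs (corr (N * P) (useq R (N * P) pi I i) (useq R (N * P) pi I i') tau)
    = P%:R.
Proof.
move=> piP ii'; have [t tP] := CFR_gidx_diff i i' tau piP ii'.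
apply: complexI; rewrite cabsE corr_useq (big_pred1 t) //.
rewrite normrM normrX normf_div !normrX omega_norm !expr1n divr1 expr1n mulr1.
by rewrite normr_nat rmorph_nat.
Qed.

(** At the shift [tau = N k], the phase [z^(- l_t tau)] equals [w^(l_t k)]. *)
Let w := ((z ^+ N)^-1 : R[i]).

(** The inverse of [z^N] is its conjugate, and conjugation, a field morphism, preserves the order
    [P]. *)
Lemma omega_inv_prim : P.-primitive_root w.
Proof.
rewrite /w -exprVn -(unity_root_conjC _ _ _ NP0 (prim_expr_order zP)) -rmorphXn.
rewrite fmorph_primitive_root -{1}(mulKn P N0).
have -> : z ^+ N = z ^+ (N * P %/ P) by rewrite mulnK.
by rewrite mulKn //; apply: dvdn_prim_root => //; apply: dvdn_mull.
Qed.

(** For equal rows the congruence no longer involves [t], so either all terms survive or none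
    does. *)
Lemma corr_useq_auto (i : 'I_M) (tau : nat) :
  corr (N * P) (useq R (N * P) pi I i) (useq R (N * P) pi I i) tau =
  if (N %| tau)%N then P%:R * char_sum _ _ w (~: I) (tau %/ N) else 0.
Proof.
rewrite corr_useq.
have E t : (gidx pi i t == gidx pi i t + tau %[mod N])%N = (N %| tau)%N.
  by rewrite -{1}[gidx pi i t]addn0 eqn_modDl mod0n eq_sym.
under eq_bigl do rewrite E.
case: ifP => [Ntau|]; last by rewrite big_pred0_eq mulr0.
congr (_ * _); rewrite /char_sum.
rewrite -(sum_lidx _ _ _ cardI _ (fun d => (w ^+ (tau %/ N)) ^+ d)).
apply: eq_bigr => t _; congr (_ ^+ _).
rewrite /w exprVn -exprM [(N * (_ %/ _))%N]mulnC divnK // exprD invfM mulrA divff ?mul1r //.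
by rewrite expf_neq0.
Qed.

Lemma inOmegaP (n : nat) : (n < N * P)%N ->
  inOmega N I n <-> Ordinal (ltn_pmod n P0) \in I.
Proof.
move=> nNP; split=> [[s [a [sI aN E]]]|nI].
  rewrite (_ : Ordinal _ = s) //; apply: val_inj.
  by rewrite /= E addnC modnMDl modn_small.
exists (Ordinal (ltn_pmod n P0)), (n %/ P)%N; split=> //=.
  by rewrite ltn_divLR.
by rewrite addnC -divn_eq.
Qed.

Lemma cabs_uhat (i : 'I_M) (n : nat) :
  Ordinal (ltn_pmod n P0) \notin I ->
  cabs (uhat R pi I i n) = Num.sqrt (P%:R / N%:R).
Proof.
move=> nI; have [t nt] := lidx_surj _ _ _ cardI _ nI.
apply: complexI; rewrite cabsE (uhatE _ _ t) //.
rewrite normrM normrX omega_norm expr1n mulr1 ger0_norm //.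
by rewrite ler0c sqrtr_ge0.
Qed.

End Sequences.

(** * Correlation bounds and spectral nulls *)

Theorem theorem6 (R : realType) (N M T P L : nat)
    (pi : 'I_M -> {perm 'I_N}) (I : {set 'I_P}) :
  (3 <= N)%N -> (2 <= M)%N -> CFR pi -> (1 <= T)%N ->
  P = (N + T)%N -> L = (N * P)%N -> #|I| = T ->
  [/\ P%:R * Num.sqrt (N%:R * (P%:R - N%:R) / (P%:R - 1)) <= theta_a R L pi I,
      (exists k lam, cyclic_difference_set k lam (~: I)) ->
        theta_a R L pi I = P%:R * Num.sqrt (N%:R * (P%:R - N%:R) / (P%:R - 1)),
      theta_c R L pi I = P%:R &
      forall (i : 'I_M) (n : nat), (n < L)%N ->
        (inOmega N I n -> uhat R pi I i n = 0) /\
        (~ inOmega N I n -> cabs (uhat R pi I i n) = Num.sqrt (P%:R / N%:R))].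
Proof.
move=> N3 M2 piP T1 PNT LNP cardI; subst L.
have N0 : (0 < N)%N by lia.
have P0 : (0 < P)%N by lia.
have P1 : (1 < P)%N by lia.
have P1R : 0 < P%:R - 1 :> R by rewrite subr_gt0 ltr1n.
have cardD : #|~: I| = N by have := cardsC I; rewrite card_ord; lia.
have M0 : (0 < M)%N by lia.
set w := ((omega R (N * P) ^+ N)^-1 : R[i]).
have wP : P.-primitive_root w := omega_inv_prim R N P N0 P0.
pose S tau := cabs (char_sum _ _ w (~: I) tau).
have cabs_auto (i : 'I_M) tau :
    cabs (corr (N * P) (useq R (N * P) pi I i) (useq R (N * P) pi I i) tau) =
    if (N %| tau)%N then P%:R * S (tau %/ N)%N else 0.
  rewrite corr_useq_auto //; apply: complexI; rewrite cabsE.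
  by case: ifP => _; rewrite ?normr0 // normrM normr_nat rmorphM /= rmorph_nat cabsE.
have sumS : \sum_(tau < P | (0 < tau)%N) S tau ^+ 2 = N%:R * (P%:R - N%:R) :> R.
  apply: complexI; rewrite rmorph_sum /=.
  under eq_bigr do rewrite rmorphXn /= cabsE.
  rewrite sum_sqr_norm_char_sum_neq0 // cardD rmorphM rmorphB /= !rmorph_nat.
  by [].
have cardP : #|[pred tau : 'I_P | (0 < tau)%N]| = P.-1.
  have := cardC1 (Ordinal P0); rewrite card_ord => <-; apply: eq_card => t.
  by rewrite !inE lt0n.
have P1E : P.-1%:R = P%:R - 1 :> R by rewrite -subn1 natrB.
have lower : P%:R * Num.sqrt (N%:R * (P%:R - N%:R) / (P%:R - 1)) <=
    theta_a R (N * P) pi I.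
  set m := theta_a _ _ _ _.
  (* The nontrivial sum [S tau] is realised by row 0 at the shift [N * tau], which is below [L]. *)
  have Sm tau : (0 < tau < P)%N -> P%:R * S tau <= m.
    move=> /andP[tau0 tauP]; have lt : (N * tau < N * P)%N by rewrite ltn_pmul2l.
    apply: le_trans (le_bigmax _ _ (Ordinal M0)).
    apply: le_trans (le_bigmax_cond _ (j := Ordinal lt) _ _); last first.
      by rewrite /= muln_gt0 N0.
    by rewrite /= cabs_auto dvdn_mulr // mulKn.
  have S0 tau : 0 <= S tau by rewrite -ler0c cabsE.
  have m0 : 0 <= m.
    by apply: le_trans (Sm 1%N _); rewrite ?P1 // mulr_ge0.
  (* The maximum dominates the mean: sum the squared bounds over the [P - 1] nonzero [tau]. *)
  have : P%:R ^+ 2 * (N%:R * (P%:R - N%:R)) <= m ^+ 2 * (P%:R - 1).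
    rewrite -sumS mulr_sumr -P1E mulr_natr -cardP -sumr_const.
    apply: ler_sum => tau tau0; rewrite -exprMn ler_sqr ?nnegrE ?mulr_ge0 //.
    by rewrite Sm // tau0 /=.
  rewrite -ler_pdivrMr // => le_m.
  rewrite -(ger0_norm m0) -sqrtr_sqr -[X in X * _](@ger0_norm R) ?ler0n //.
  rewrite -sqrtr_sqr -sqrtrM ?sqr_ge0 //; apply: ler_wsqrtr.
  by rewrite mulrA.
split=> //.
- move=> [k [lam Dlam]]; apply/eqP; rewrite eq_le lower andbT.
  have Sc tau : (0 < tau < P)%N -> S tau ^+ 2 = N%:R - lam%:R.
    move=> tauP; apply: complexI; rewrite rmorphXn /= cabsE.
    rewrite (sqr_norm_char_sum_diffset _ _ _ _ wP _ _ _ Dlam) // cardD.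
    by rewrite rmorphB /= !rmorph_nat.
  (* The squared moduli all equal [N - lam], hence equal their mean; this identifies [lam]. *)
  have lamE : N%:R * (P%:R - N%:R) / (P%:R - 1) = N%:R - lam%:R :> R.
    rewrite -sumS (eq_bigr (fun=> N%:R - lam%:R)); last first.
      by move=> tau tau0; rewrite Sc // tau0 /=.
    by rewrite sumr_const cardP -[_ *+ P.-1]mulr_natr P1E mulfK // gt_eqF.
  have B0 : 0 <= P%:R * Num.sqrt (N%:R * (P%:R - N%:R) / (P%:R - 1)) :> R.
    by rewrite mulr_ge0 ?sqrtr_ge0.
  apply: bigmax_le => // i _; apply: bigmax_le => // tau tau0.
  (* Shifts not divisible by [N] give 0, which [B0] covers. *)
  rewrite cabs_auto; case: ifP => // Ntau.
  rewrite lamE -(Sc (tau %/ N)%N) ?sqrtr_sqr ?ler_wpM2l ?ler_norm //.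
  by rewrite divn_gt0 // dvdn_leq //= ltn_divLR // [(P * N)%N]mulnC.
- apply/le_anti/andP; split.
    apply: bigmax_le => // i _; apply: bigmax_le => // i' ii'.
    by apply: bigmax_le => // tau _; rewrite corr_useq_cross.
  have NP0 : (0 < N * P)%N by rewrite muln_gt0 N0.
  (* Rows 0 and 1 at shift 0 already attain the value [P]. *)
  pose i0 := Ordinal M0; pose i1 := Ordinal M2.
  apply: le_trans (le_bigmax _ _ i0).
  apply: le_trans (le_bigmax_cond _ (j := i1) _ _) => //.
  apply: le_trans (le_bigmax _ _ (Ordinal NP0)).
  by rewrite corr_useq_cross.
- move=> i n nL; split=> [|nO].
    by move=> /(inOmegaP _ _ _ P0 _ nL) /uhat_in -> //.
  apply: cabs_uhat => //; apply/negP => nI; apply: nO.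
  exact/(inOmegaP _ _ _ P0 _ nL).
Qed.
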